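(* Let $A$ be a Hopf algebra with a bicovariant first-order differential calculus $(\Gamma,d)$, with basis $\{\omega^i\}$ of left-invariant $1$-forms and dual basis $\{t_i\}$ of left-invariant vectorfields, and let $\Xi$ be the right $A$-module of vectorfields. There exists a unique map $$\langle\ ,\ \rangle:\Gamma\times\Xi\longrightarrow A$$ such that: 1) for every $V\in\Xi$ the map $\langle\ ,V\rangle:\Gamma\to A$ is a left $A$-module morphism, i.e. it is linear and $\langle a\rho,V\rangle=a\langle\rho,V\rangle$; 2) for every $\rho\in\Gamma$ the map $\langle\rho,\ \rangle:\Xi\to A$ is a right $A$-module morphism, i.e. it is linear and $\langle\rho,V\diamond b\rangle=\langle\rho,V\rangle b$; 3) if $\rho\in\Gamma$ and $\langle\rho,V\rangle=0$ for all $V\in\Xi$, then $\rho=0$; 4) if $V\in\Xi$ and $\langle\rho,V\rangle=0$ for all $\rho\in\Gamma$, then $V=0$; 5) on left-invariant elements, $\langle\omega^i,t_j\rangle=\delta^i_j I$.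
   Context: Repeated indices are summed. $A$ is a Hopf algebra over $\mathbf{C}$ with coproduct $\Delta$, counit $\varepsilon$, unit $I$ and invertible antipode. A bicovariant first-order differential calculus $(\Gamma,d)$ is an $A$-bimodule $\Gamma$ and a linear map $d:A\to\Gamma$ with $d(ab)=(da)b+a\,db$, such that every element of $\Gamma$ is a finite sum $\sum_k a_k\,db_k$, and such that the maps $\Delta_\Gamma:\Gamma\to A\otimes\Gamma$, $\Delta_\Gamma(a\,db)=\Delta(a)(id\otimes d)\Delta(b)$, and ${}_\Gamma\Delta:\Gamma\to\Gamma\otimes A$, ${}_\Gamma\Delta(a\,db)=\Delta(a)(d\otimes id)\Delta(b)$, are well defined. The space of left-invariant elements ($\Delta_\Gamma(\omega)=I\otimes\omega$) is assumed to have a finite basis $\{\omega^i\}$; every $\rho\in\Gamma$ is uniquely $\rho=a_i\omega^i$ with $a_i\in A$. The functionals $\chi_i:A\to\mathbf C$ are defined by $da=(\chi_i*a)\,\omega^i$, where $\psi*a=(id\otimes\psi)\Delta(a)$. Left-invariant vectorfields are the linear combinations of $t_i=\chi_i*:A\to A$. For a linear map $V:A\to A$ and $a\in A$, $V\diamond a:A\to A$ is $(V\diamond a)(b)=V(b)\,a$. The space of vectorfields is $\Xi=\{V:A\to A\ /\ V=t_i\diamond a^i,\ a^i\in A\}$, a right $A$-module under $\diamond$. *)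

(* Defs.v *)
From HB Require Import structures.
From mathcomp Require Import all_boot all_order all_algebra.
From mathcomp Require Import boolp functions.

Set Implicit Arguments.
Unset Strict Implicit.
Unset Printing Implicit Defensive.

Import GRing.Theory.
Local Open Scope ring_scope.
Local Open Scope quotient_scope.

(* The tensor product over K.  A list [:: (u_1, v_1); ...; (u_n, v_n)] stands
   for the formal sum of the u_k (x) v_k, so lists modulo the least additive
   congruence containing the bilinearity relations are the usual quotient of
   the free commutative monoid on U * V.  No formal scalars are needed, since
   a multiple of a pure tensor is again a pure tensor; opposites likewise. *)
Section TensorCongruence.
Variables (K : fieldType) (U V : lmodType K).

Inductive teq : seq (U * V) -> seq (U * V) -> Prop :=
| teq_refl s : teq s s
| teq_sym s t : teq s t -> teq t s
| teq_trans r s t : teq s r -> teq r t -> teq s t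
| teq_cat s s' t t' : teq s s' -> teq t t' -> teq (s ++ t) (s' ++ t')
| teq_comm s t : teq (s ++ t) (t ++ s)
| teq_zero v : teq [:: (0, v)] [::]
| teq_addl u u' v : teq [:: (u + u', v)] [:: (u, v); (u', v)]
| teq_addr u v v' : teq [:: (u, v + v')] [:: (u, v); (u, v')]
| teq_scale (c : K) u v : teq [:: (c *: u, v)] [:: (u, c *: v)].

Definition teqb (s t : seq (U * V)) : bool := `[< teq s t >].

Lemma teqb_refl : reflexive teqb.
Proof. by move=> s; apply/asboolP; apply: teq_refl. Qed.

Lemma teqb_sym : symmetric teqb.
Proof.
by move=> s t; apply/idP/idP => /asboolP h; apply/asboolP; apply: teq_sym.
Qed.

Lemma teqb_trans : transitive teqb.
Proof.
move=> r s t /asboolP h1 /asboolP h2; apply/asboolP.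
exact: (teq_trans h1 h2).
Qed.

Canonical teq_equiv := EquivRel teqb teqb_refl teqb_sym teqb_trans.

Definition tens : Type := {eq_quot teq_equiv}.
HB.instance Definition _ := Choice.on tens.

Definition tens_of (s : seq (U * V)) : tens := \pi_{eq_quot teq_equiv} s.
Definition tens_repr (x : tens) : seq (U * V) := repr (x : {eq_quot teq_equiv}).

Lemma tens_reprK x : tens_of (tens_repr x) = x.
Proof. exact: reprK. Qed.

Lemma tens_ofP s t : tens_of s = tens_of t <-> teq s t.
Proof.
split=> [/(@eqmodP _ teq_equiv s t)/asboolP //|h].
by apply/(@eqmodP _ teq_equiv s t)/asboolP.
Qed.

Lemma teq_repr s : teq (tens_repr (tens_of s)) s.
Proof. by apply/tens_ofP; rewrite tens_reprK. Qed.

Definition tens_scales (c : K) (s : seq (U * V)) := [seq (c *: p.1, p.2) | p <- s].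

Lemma teq_scales c s t : teq s t -> teq (tens_scales c s) (tens_scales c t).
Proof.
elim=> {s t} /=.
- by move=> s; apply: teq_refl.
- by move=> s t _ h; apply: teq_sym.
- by move=> r s t _ h1 _ h2; apply: teq_trans h1 h2.
- by move=> s s' t t' _ h1 _ h2; rewrite /tens_scales !map_cat; apply: teq_cat.
- by move=> s t; rewrite /tens_scales !map_cat; apply: teq_comm.
- by move=> v; rewrite scaler0; apply: teq_zero.
- by move=> u u' v; rewrite scalerDr; apply: teq_addl.
- by move=> u v v'; apply: teq_addr.
- by move=> a u v; rewrite scalerA mulrC -scalerA; apply: teq_scale.
Qed.

Definition tens_add (x y : tens) := tens_of (tens_repr x ++ tens_repr y).
Definition tens_scale (c : K) (x : tens) := tens_of (tens_scales c (tens_repr x)).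
Definition tens_opp (x : tens) := tens_scale (-1) x.

Lemma tens_add_of s t : tens_add (tens_of s) (tens_of t) = tens_of (s ++ t).
Proof. by apply/tens_ofP; apply: teq_cat; apply: teq_repr. Qed.

Lemma tens_scale_of c s : tens_scale c (tens_of s) = tens_of (tens_scales c s).
Proof. by apply/tens_ofP; apply: teq_scales; apply: teq_repr. Qed.

Lemma tens_addA : associative tens_add.
Proof.
move=> x y z; rewrite -(tens_reprK x) -(tens_reprK y) -(tens_reprK z).
by rewrite !tens_add_of catA.
Qed.

Lemma tens_addC : commutative tens_add.
Proof. by move=> x y; apply/tens_ofP; apply: teq_comm. Qed.

Lemma tens_add0 : left_id (tens_of [::]) tens_add.
Proof. by move=> x; rewrite -(tens_reprK x) tens_add_of. Qed.

Lemma tens_scale0_of s : teq (tens_scales 0 s) [::].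
Proof.
elim: s => [|[u v] s ih] /=; first exact: teq_refl.
rewrite scale0r -[X in teq _ X]cat0s -cat1s.
by apply: teq_cat => //; apply: teq_zero.
Qed.

Lemma tens_scaleDl_of a b s :
  teq (tens_scales (a + b) s) (tens_scales a s ++ tens_scales b s).
Proof.
elim: s => [|[u v] s ih] /=; first exact: teq_refl.
rewrite scalerDl -cat1s.
apply: teq_trans; first by apply: teq_cat; [apply: teq_addl | exact: ih].
set sa := tens_scales a s; set sb := tens_scales b s.
apply: (@teq_cat [:: (a *: u, v)] [:: (a *: u, v)]
  (([:: (b *: u, v)] ++ sa) ++ sb) (sa ++ ([:: (b *: u, v)] ++ sb))).
  exact: teq_refl.
by rewrite [X in teq _ X]catA; apply: teq_cat; [apply: teq_comm | apply: teq_refl].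
Qed.

Lemma tens_addN : left_inverse (tens_of [::]) tens_opp tens_add.
Proof.
move=> x; rewrite -(tens_reprK x) /tens_opp tens_scale_of tens_add_of.
set s := tens_repr x.
have {2}-> : s = tens_scales 1 s.
  rewrite /tens_scales -[LHS]map_id.
  by apply: eq_map => -[u v] /=; rewrite scale1r.
apply/tens_ofP; apply: teq_trans; first by apply: teq_sym; apply: tens_scaleDl_of.
by rewrite addNr; apply: tens_scale0_of.
Qed.

HB.instance Definition _ :=
  GRing.isZmodule.Build tens tens_addA tens_addC tens_add0 tens_addN.

Lemma tens_scaleA a b x : tens_scale a (tens_scale b x) = tens_scale (a * b) x.
Proof.
rewrite -(tens_reprK x) !tens_scale_of /tens_scales -map_comp; congr tens_of.
by apply: eq_map => -[u v] /=; rewrite scalerA.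
Qed.

Lemma tens_scale1 : left_id 1 tens_scale.
Proof.
move=> x; rewrite -[in LHS](tens_reprK x) tens_scale_of -[RHS]tens_reprK.
congr tens_of; rewrite /tens_scales -[RHS]map_id.
by apply: eq_map => -[u v] /=; rewrite scale1r.
Qed.

Lemma tens_scaleDr : right_distributive tens_scale +%R.
Proof.
move=> a x y; rewrite -(tens_reprK x) -(tens_reprK y).
have addE (p q : tens) : p + q = tens_add p q by [].
set s := tens_repr x; set t := tens_repr y.
rewrite !addE (tens_add_of s t) !tens_scale_of (tens_add_of (tens_scales a s)).
by rewrite /tens_scales map_cat.
Qed.

Lemma tens_scaleDl x : {morph tens_scale^~ x : a b / a + b}.
Proof.
move=> a b /=; rewrite -(tens_reprK x).
have addE (p q : tens) : p + q = tens_add p q by [].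
rewrite addE !tens_scale_of tens_add_of.
by apply/tens_ofP; apply: tens_scaleDl_of.
Qed.

HB.instance Definition _ := GRing.Zmodule_isLmodule.Build K tens
  tens_scaleA tens_scale1 tens_scaleDr tens_scaleDl.

Definition pure (u : U) (v : V) : tens := tens_of [:: (u, v)].

End TensorCongruence.

Notation "U ⊗ V" := (tens U%type V%type) (at level 40, left associativity) : type_scope.
Notation "u ⊗ v" := (pure u v) (at level 40, left associativity) : ring_scope.

Definition bilin (K : fieldType) (U V W : lmodType K) (f : U -> V -> W) :=
  (forall v, linear (f ^~ v)) /\ (forall u, linear (f u)).

Section UniversalProperty.
Variables (K : fieldType) (U V W : lmodType K).
Implicit Types (f : U -> V -> W).

(* The linear map U ⊗ V -> W induced by f; meaningful for bilinear f only. *)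
Definition tlift f (x : U ⊗ V) : W := \sum_(p <- tens_repr x) f p.1 p.2.

Lemma pure_bilin : bilin (@pure K U V).
Proof.
have sumE s t : tens_of s + tens_of t = tens_of (s ++ t) :> U ⊗ V.
  exact: tens_add_of.
have scE c s : c *: tens_of s = tens_of (tens_scales c s) :> U ⊗ V.
  exact: tens_scale_of.
split=> [v c u u'|u c v v'] /=; rewrite /pure scE sumE /=; apply/tens_ofP.
  exact: teq_addl.
apply: teq_trans; first exact: teq_addr.
apply: (@teq_cat _ _ _ [:: (u, c *: v)] [:: (c *: u, v)] [:: (u, v')] [:: (u, v')]); last exact: teq_refl.
by apply: teq_sym; apply: teq_scale.
Qed.

Lemma tens_sumE (x : U ⊗ V) : x = \sum_(p <- tens_repr x) p.1 ⊗ p.2.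
Proof.
rewrite -[LHS]tens_reprK; elim: (tens_repr x) => [|[u v] s ih].
  by rewrite big_nil.
rewrite big_cons -ih; apply/esym; exact: tens_add_of.
Qed.

Lemma tens_ind (P : U ⊗ V -> Prop) : P 0 ->
  (forall u v x, P x -> P (u ⊗ v + x)) -> forall x, P x.
Proof.
move=> P0 PS x; rewrite (tens_sumE x).
elim: (tens_repr x) => [|[u v] s ih]; first by rewrite big_nil.
by rewrite big_cons; apply: PS.
Qed.

Lemma tlift_of f s : bilin f ->
  tlift f (tens_of s) = \sum_(p <- s) f p.1 p.2.
Proof.
move=> [fl fr]; rewrite /tlift; have := teq_repr s.
move: (tens_repr _) => t; elim=> {s t} /=.
- by [].
- by move=> s t _ ->.
- by move=> r s t _ -> _ ->.
- by move=> s s' t t' _ h1 _ h2; rewrite !big_cat /= h1 h2.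
- by move=> s t; rewrite !big_cat /= addrC.
- move=> v; rewrite big_seq1 big_nil /=.
  by have := fl v (-1) 0 0; rewrite scaler0 addr0 scaleN1r addNr.
- move=> u u' v; rewrite !big_cons !big_nil !addr0 /=.
  by have := fl v 1 u u'; rewrite !scale1r.
- move=> u v v'; rewrite !big_cons !big_nil !addr0 /=.
  by have := fr u 1 v v'; rewrite !scale1r.
- move=> c u v; rewrite !big_seq1 /=.
  have l0 : f 0 v = 0.
    by have := fl v (-1) 0 0; rewrite scaler0 addr0 scaleN1r addNr.
  have r0 : f u 0 = 0.
    by have := fr u (-1) 0 0; rewrite scaler0 addr0 scaleN1r addNr.
  have := fl v c u 0; have := fr u c v 0.
  by rewrite !addr0 l0 r0 !addr0 => -> ->.
Qed.

Lemma tlift_pure f u v : bilin f -> tlift f (u ⊗ v) = f u v.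
Proof. by move=> bf; rewrite tlift_of // big_seq1. Qed.

Lemma tlift_linear f : bilin f -> linear (tlift f).
Proof.
move=> bf c x y; rewrite -(tens_reprK x) -(tens_reprK y).
have sumE s t : tens_of s + tens_of t = tens_of (s ++ t) :> U ⊗ V.
  exact: tens_add_of.
have scE s : c *: tens_of s = tens_of (tens_scales c s) :> U ⊗ V.
  exact: tens_scale_of.
rewrite scE sumE !tlift_of // big_cat /=; congr (_ + _).
rewrite big_map scaler_sumr; apply: eq_bigr => -[u v] _ /=.
have := bf.1 v c u 0; rewrite addr0 => ->.
have -> : f 0 v = 0.
  by have := bf.1 v (-1) 0 0; rewrite scaler0 addr0 scaleN1r addNr.
by rewrite addr0.
Qed.

End UniversalProperty.

Definition tmap (K : fieldType) (U V U' V' : lmodType K)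
    (f : U -> U') (g : V -> V') : U ⊗ V -> U' ⊗ V' :=
  tlift (fun u v => f u ⊗ g v).

(* Componentwise product (x ⊗ y) (x' ⊗ y') = mu x x' ⊗ nu y y'. *)
Definition tmul (K : fieldType) (U1 U2 U3 V1 V2 V3 : lmodType K)
    (mu : U1 -> U2 -> U3) (nu : V1 -> V2 -> V3)
    (s : U1 ⊗ V1) (t : U2 ⊗ V2) : U3 ⊗ V3 :=
  tlift (fun x y => tlift (fun x' y' => mu x x' ⊗ nu y y') t) s.

Definition tassoc (K : fieldType) (U V W : lmodType K) :
    (U ⊗ V) ⊗ W -> U ⊗ (V ⊗ W) :=
  tlift (fun t w => tlift (fun u v => u ⊗ (v ⊗ w)) t).

HB.mixin Record isHopfAlgebra (K : fieldType) A of GRing.Algebra K A := {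
  coprod : {linear A -> (A ⊗ A)%type};
  counit : {linear A -> K^o};
  antipode : {linear A -> A};
  coprodM : forall a b : A,
    coprod (a * b) = tmul ( *%R ) ( *%R ) (coprod a) (coprod b);
  coprod1 : coprod 1 = 1 ⊗ 1;
  counitM : forall a b : A, counit (a * b) = counit a * counit b;
  counit1 : counit 1 = 1;
  coassoc : forall a : A,
    tassoc (tmap coprod id (coprod a)) = tmap id coprod (coprod a);
  counitl : forall a : A, tlift (fun x y => counit x *: y) (coprod a) = a;
  counitr : forall a : A, tlift (fun x y => counit y *: x) (coprod a) = a;
  antipodel : forall a : A,
    tlift (fun x y => antipode x * y) (coprod a) = (counit a)%:A;
  antipoder : forall a : A,
    tlift (fun x y => x * antipode y) (coprod a) = (counit a)%:A;
  antipode_bij : bijective antipode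
}.

#[short(type="hopfAlgType")]
HB.structure Definition HopfAlgebra (K : fieldType) :=
  {A of isHopfAlgebra K A & GRing.Algebra K A}.

HB.mixin Record isBimodule (K : fieldType) (A : algType K) M
    of GRing.Lmodule K M := {
  lact : A -> M -> M;
  ract : M -> A -> M;
  lact_bilin : bilin lact;
  ract_bilin : bilin ract;
  lact1 : forall m, lact 1 m = m;
  lactM : forall a b m, lact (a * b) m = lact a (lact b m);
  ract1 : forall m, ract m 1 = m;
  ractM : forall m a b, ract m (a * b) = ract (ract m a) b;
  lract : forall a m b, lact a (ract m b) = ract (lact a m) b
}.

#[short(type="bimodType")]
HB.structure Definition Bimodule (K : fieldType) (A : algType K) :=
  {M of isBimodule K A M & GRing.Lmodule K M}.

Notation "a ▷ m" := (lact a m) (at level 40, left associativity) : ring_scope.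
Notation "m ◁ a" := (ract m a) (at level 40, left associativity) : ring_scope.

(* As every element of Gamma is a finite sum of a_k db_k, the coactions are
   well defined exactly when linear maps with the prescribed values on the
   a db exist, and these are then unique. *)
Record bicovariant_calculus (K : fieldType) (A : hopfAlgType K)
    (Gamma : bimodType A) := BicovariantCalculus {
  diff : {linear A -> Gamma};
  diffM : forall a b : A, diff (a * b) = diff a ◁ b + a ▷ diff b;
  diff_gen : forall rho : Gamma,
    exists s : seq (A * A), rho = \sum_(p <- s) p.1 ▷ diff p.2;
  lcoact : {linear Gamma -> (A ⊗ Gamma)%type};
  lcoactE : forall a b : A,
    lcoact (a ▷ diff b)
    = tmul ( *%R ) (@lact _ A Gamma) (coprod a) (tmap id diff (coprod b));
  rcoact : {linear Gamma -> (Gamma ⊗ A)%type};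
  rcoactE : forall a b : A,
    rcoact (a ▷ diff b)
    = tmul (@lact _ A Gamma) ( *%R ) (coprod a) (tmap diff id (coprod b))
}.

Section LeftInvariantForms.
Variables (K : fieldType) (A : hopfAlgType K) (Gamma : bimodType A).
Variable C : bicovariant_calculus Gamma.

Definition left_invariant (rho : Gamma) : Prop := lcoact C rho = 1 ⊗ rho.

Definition left_invariant_basis (n : nat) (omega : 'I_n -> Gamma) : Prop :=
  [/\ forall i, left_invariant (omega i),
      forall c : 'I_n -> K, \sum_i c i *: omega i = 0 -> forall i, c i = 0
    & forall rho, left_invariant rho ->
        exists c : 'I_n -> K, rho = \sum_i c i *: omega i].

(* psi * a = (id ⊗ psi) (Delta a), with A ⊗ K identified with A. *)
Definition conv (psi : A -> K) (a : A) : A :=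
  tlift (fun x y => psi y *: x) (coprod a).

Definition dual_functionals (n : nat) (omega : 'I_n -> Gamma)
    (chi : 'I_n -> {linear A -> K^o}) : Prop :=
  forall a : A, diff C a = \sum_i conv (chi i) a ▷ omega i.

End LeftInvariantForms.

Section Vectorfields.
Variables (K : fieldType) (A : hopfAlgType K).
Variables (n : nat) (chi : 'I_n -> {linear A -> K^o}).

Definition diamond (V : A -> A) (a : A) : A -> A := fun b => V b * a.

Definition tvec (i : 'I_n) : A -> A := conv (chi i).

Definition is_vectorfield : {pred A -> A} := fun V =>
  `[< exists a : 'I_n -> A, V = \sum_i diamond (tvec i) (a i) >].

Lemma is_vectorfieldP V : reflect
  (exists a : 'I_n -> A, V = \sum_i diamond (tvec i) (a i)) (V \in is_vectorfield).
Proof. exact: asboolP. Qed.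

Lemma is_vectorfield_submod : submod_closed is_vectorfield.
Proof.
split=> [|c _ _ /is_vectorfieldP[a ->] /is_vectorfieldP[b ->]]; apply/is_vectorfieldP.
  exists (fun=> 0); rewrite big1 // => i _.
  by apply/funext => x; rewrite /diamond mulr0.
exists (fun i => c *: a i + b i); rewrite scaler_sumr -big_split /=.
by apply: eq_bigr => i _; apply/funext => x; rewrite /diamond mulrDr -scalerAr.
Qed.

HB.instance Definition _ :=
  GRing.isSubmodClosed.Build K (A -> A) is_vectorfield is_vectorfield_submod.

(* A subspace of the K-vector space of all maps A -> A. *)
Record vectorfield : Type := Vectorfield {
  vf_fun :> A -> A;
  vf_funP : vf_fun \in is_vectorfield
}.

HB.instance Definition _ := [isSub for vf_fun].
HB.instance Definition _ := [Choice of vectorfield by <:].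
HB.instance Definition _ := [SubChoice_isSubLmodule of vectorfield by <:].

Lemma diamond_vectorfield V a : V \in is_vectorfield ->
  diamond V a \in is_vectorfield.
Proof.
move=> /is_vectorfieldP[b ->]; apply/is_vectorfieldP.
exists (fun i => b i * a); apply/funext => x.
rewrite /diamond !fct_sumE mulr_suml.
by apply: eq_bigr => i _; rewrite mulrA.
Qed.

Definition vf_diamond (V : vectorfield) (a : A) : vectorfield :=
  Vectorfield (diamond_vectorfield a (vf_funP V)).

Lemma tvec_vectorfield i : tvec i \in is_vectorfield.
Proof.
apply/is_vectorfieldP; exists (fun j => (j == i)%:R); apply/funext => x.
rewrite fct_sumE (bigD1 i) //= /diamond eqxx mulr1 big1 ?addr0 // => j /negPf ->.
by rewrite mulr0.
Qed.

Definition vf_tvec (i : 'I_n) : vectorfield := Vectorfield (tvec_vectorfield i).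

End Vectorfields.

(* Main.v *)
Require Import Defs.
From mathcomp Require Import all_boot all_order all_algebra.
From mathcomp Require Import boolp functions reals complex.

Set Implicit Arguments.
Unset Strict Implicit.
Unset Printing Implicit Defensive.

Import GRing.Theory.
Local Open Scope ring_scope.

(** The point is that the left-invariant forms omega_i are a basis of the left
    [A]-module [Gamma], with coordinates computed from the coaction.  Every form
    is a sum of a_i omega_i ([form_decomposition]), because the a_k db_k span
    and db = (chi_i * b) omega_i.  The coaction satisfies
    Delta_Gamma (a omega_i) = a_(1) (x) a_(2) omega_i, so the map
    P rho = S(rho_(-1)) rho_(0) sends the sum of the a_i omega_i to the sum of
    the counit(a_i) omega_i ([inv_proj_sum]).  As the omega_i are linearly
    independent over the base field, the scalars c_i(rho) = counit(a_i) depend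
    on rho only ([inv_coord_sum]), and are linear in rho.  Applying id (x) c_i
    to Delta_Gamma rho then recovers a_i: this is the coordinate function
    [coord] ([coord_sum]).

    The bracket of rho with V is the sum of the a_k V(b_k) when rho is the sum
    of the a_k db_k.  If V is the sum of the maps b |-> t_i(b) v_i, this equals
    the sum of the coord_i(rho) v_i ([pairing_coord]), so it does not depend on
    how rho is written; as a_k V(b_k) does not mention the v_i, it does not
    depend on how V is written either, and freeness of the t_i is not needed.
    Nondegeneracy follows from <rho, t_i> = coord_i(rho) and <db, V> = V(b), and
    uniqueness from the fact that the omega_i and the t_j generate the two
    modules ([bracket_coord]). *)

(** * Linear and bilinear maps given as predicates *)

Section Linear.
Variables (K : fieldType) (U V W : lmodType K).

Lemma lin0 (f : U -> V) : linear f -> f 0 = 0.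
Proof.
by move=> lf; have := lf (-1) 0 0; rewrite scaler0 addr0 scaleN1r addNr.
Qed.

Lemma linD (f : U -> V) : linear f -> {morph f : x y / x + y}.
Proof. by move=> lf x y; have := lf 1 x y; rewrite !scale1r. Qed.

Lemma lin_sum (f : U -> V) : linear f -> forall I (s : seq I) (F : I -> U),
  f (\sum_(i <- s) F i) = \sum_(i <- s) f (F i).
Proof.
move=> lf I s F; elim: s => [|i s ih]; first by rewrite !big_nil lin0.
by rewrite !big_cons linD // ih.
Qed.

Lemma linear_bigsum I (s : seq I) (F : I -> U -> V) :
  (forall i, linear (F i)) -> linear (fun x => \sum_(i <- s) F i x).
Proof.
move=> lF c x y; rewrite scaler_sumr -big_split /=.
by apply: eq_bigr => i _; apply: lF.
Qed.

Lemma linear_comp (f : V -> W) (g : U -> V) :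
  linear f -> linear g -> linear (f \o g).
Proof. by move=> lf lg c x y; rewrite /= lg lf. Qed.

End Linear.

Lemma linear_tens_ext (K : fieldType) (U V W : lmodType K)
    (f g : (U ⊗ V)%type -> W) :
  linear f -> linear g -> (forall u v, f (u ⊗ v) = g (u ⊗ v)) -> f =1 g.
Proof.
move=> lf lg fg; elim/tens_ind => [|u v x ih].
  by rewrite (lin0 lf) (lin0 lg).
by rewrite (linD lf) (linD lg) fg ih.
Qed.

Lemma mulr_bilin (K : fieldType) (A : algType K) :
  bilin (@GRing.mul A : A -> A -> A).
Proof.
split=> [v c x y|u c x y] /=; first by rewrite mulrDl scalerAl.
by rewrite mulrDr scalerAr.
Qed.

Section TensorProduct.
Variables (K : fieldType) (U1 U2 U3 V1 V2 V3 : lmodType K).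
Variables (mu : U1 -> U2 -> U3) (nu : V1 -> V2 -> V3).
Hypotheses (mu_bilin : bilin mu) (nu_bilin : bilin nu).

Let inner_bilin x y : bilin (fun x' y' => mu x x' ⊗ nu y y').
Proof.
have [pl pr] := pure_bilin U3 V3.
split=> [v|u]; first exact: (linear_comp (pl _) (mu_bilin.2 x)).
exact: (linear_comp (pr _) (nu_bilin.2 y)).
Qed.

Let outer_bilin t :
  bilin (fun x y => tlift (fun x' y' => mu x x' ⊗ nu y y') t).
Proof.
have [pl pr] := pure_bilin U3 V3.
split=> [v|u]; apply: linear_bigsum => -[x' y'] /=.
  exact: (linear_comp (pl _) (mu_bilin.1 x')).
exact: (linear_comp (pr _) (nu_bilin.1 y')).
Qed.

Lemma tmul_bilin : bilin (tmul mu nu).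
Proof.
split=> [t|s]; first exact: tlift_linear (outer_bilin t).
by apply: linear_bigsum => -[x y]; apply: tlift_linear.
Qed.

Lemma tmul_pure x y x' y' :
  tmul mu nu (x ⊗ y) (x' ⊗ y') = mu x x' ⊗ nu y y'.
Proof. by rewrite /tmul tlift_pure // tlift_pure. Qed.

End TensorProduct.

(** * The left coaction is a map of left modules *)

Section LeftCoaction.
Variables (K : fieldType) (A : hopfAlgType K) (Gamma : bimodType A).
Variable C : bicovariant_calculus Gamma.

Lemma lact_linearl (m : Gamma) : linear (fun a : A => a ▷ m).
Proof. exact: lact_bilin.1. Qed.

Lemma lact_linearr (a : A) : linear (fun m : Gamma => a ▷ m).
Proof. exact: lact_bilin.2. Qed.

Local Notation tact := (tmul ( *%R ) (@lact _ A Gamma)).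

(** The componentwise action of [A ⊗ A] on [A ⊗ Gamma] is associative. *)
Lemma tactA (s t : (A ⊗ A)%type) (u : (A ⊗ Gamma)%type) :
  tact (tmul *%R *%R s t) u = tact s (tact t u).
Proof.
have bM := mulr_bilin A; have bL := @lact_bilin _ A Gamma.
have [tMl tMr] := tmul_bilin bM bM; have [tLl tLr] := tmul_bilin bM bL.
move: s; apply: linear_tens_ext => [||x y].
- exact: (linear_comp (tLl u) (tMl t)).
- exact: tLl.
move: t; apply: linear_tens_ext => [||x' y'].
- exact: (linear_comp (tLl u) (tMr _)).
- exact: (linear_comp (tLr _) (tLl u)).
move: u; apply: linear_tens_ext => [||x'' m].
- exact: tLr.
- exact: (linear_comp (tLr _) (tLr _)).
by rewrite !tmul_pure // mulrA lactM.
Qed.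

Lemma lcoact_lact a rho :
  lcoact C (a ▷ rho) = tact (coprod a) (lcoact C rho).
Proof.
have [tLl tLr] := tmul_bilin (mulr_bilin A) (@lact_bilin _ A Gamma).
have [s ->] := diff_gen C rho.
rewrite (lin_sum (lact_linearr a)) !linear_sum (lin_sum (tLr _)).
apply: eq_bigr => -[b c] _ /=.
by rewrite -lactM !lcoactE coprodM tactA.
Qed.

(** With the coproduct of a written as an explicit sum of pure tensors, this is
    Delta_Gamma (a rho) = a_(1) (x) a_(2) rho. *)
Lemma lcoact_left_invariant a rho : left_invariant C rho ->
  lcoact C (a ▷ rho) = \sum_(p <- tens_repr (coprod a)) p.1 ⊗ (p.2 ▷ rho).
Proof.
move=> inv_rho; rewrite lcoact_lact inv_rho {1}(tens_sumE (coprod a)).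
have [bM bL] := (mulr_bilin A, @lact_bilin _ A Gamma).
rewrite (lin_sum ((tmul_bilin bM bL).1 _)); apply: eq_bigr => -[x y] _ /=.
by rewrite tmul_pure // mulr1.
Qed.

(** The Hopf-module projection rho |-> S(rho_(-1)) rho_(0). *)
Definition inv_proj (rho : Gamma) : Gamma :=
  tlift (fun x m => antipode x ▷ m) (lcoact C rho).

Let inv_proj_bilin : bilin (fun (x : A) (m : Gamma) => antipode x ▷ m).
Proof.
split=> [m|x]; last exact: lact_linearr.
by apply: (linear_comp (lact_linearl m)) => c x y; rewrite linearP.
Qed.

Lemma inv_proj_linear : linear inv_proj.
Proof.
apply: (linear_comp (tlift_linear inv_proj_bilin)) => c x y.
by rewrite linearP.
Qed.

Lemma inv_proj_lact a rho : left_invariant C rho ->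
  inv_proj (a ▷ rho) = (counit a : K) *: rho.
Proof.
move=> inv_rho; rewrite /inv_proj lcoact_left_invariant //.
rewrite (lin_sum (tlift_linear inv_proj_bilin)).
(* S(a_(1)) a_(2) = counit(a), acting on rho. *)
transitivity (((counit a : K)%:A : A) ▷ rho); last first.
  have := lact_linearl rho (counit a) 1 0.
  by rewrite /= (lin0 (lact_linearl rho)) !addr0 lact1.
rewrite -antipodel [in RHS]/tlift (lin_sum (lact_linearl rho)).
by apply: eq_bigr => -[x y] _; rewrite /= tlift_pure // lactM.
Qed.

(** * Coordinates of a form in a left-invariant basis *)

Variables (n : nat) (omega : 'I_n -> Gamma).
Hypothesis omega_basis : left_invariant_basis C omega.
Variable chi : 'I_n -> {linear A -> K^o}.
Hypothesis chiE : dual_functionals C omega chi.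

Lemma lact_diffE a b : a ▷ diff C b = \sum_i (a * conv (chi i) b) ▷ omega i.
Proof.
rewrite chiE (lin_sum (lact_linearr a)).
by apply: eq_bigr => i _; rewrite lactM.
Qed.

Lemma form_decomposition rho : exists a : 'I_n -> A,
  rho = \sum_i a i ▷ omega i.
Proof.
have [s ->] := diff_gen C rho.
exists (fun i => \sum_(p <- s) p.1 * conv (chi i) p.2).
under eq_bigr do rewrite lact_diffE.
rewrite exchange_big; apply: eq_bigr => i _.
by rewrite (lin_sum (lact_linearl (omega i))).
Qed.

(** The scalar c_i(rho), where inv_proj rho is the sum of the c_i(rho) omega_i;
    it is counit(a_i) for an arbitrarily chosen decomposition of rho as the sum
    of the a_i omega_i. *)
Definition inv_coord (i : 'I_n) (rho : Gamma) : K^o :=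
  counit (projT1 (cid (form_decomposition rho)) i).

Lemma inv_proj_sum (a : 'I_n -> A) :
  inv_proj (\sum_i a i ▷ omega i) = \sum_i (counit (a i) : K) *: omega i.
Proof.
have [inv_omega _ _] := omega_basis.
rewrite (lin_sum inv_proj_linear).
by apply: eq_bigr => i _; apply: inv_proj_lact.
Qed.

(** By linear independence of the omega_i, [inv_coord] does not depend on the
    chosen decomposition. *)
Lemma inv_coord_sum i (a : 'I_n -> A) :
  inv_coord i (\sum_j a j ▷ omega j) = counit (a i).
Proof.
have [_ free_omega _] := omega_basis.
rewrite /inv_coord; case: cid => b /= eq_ab.
have := congr1 inv_proj eq_ab; rewrite !inv_proj_sum => /eqP.
rewrite eq_sym -subr_eq0 -sumrB => /eqP eq0.
apply/eqP; rewrite -subr_eq0; apply/eqP.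
apply: (free_omega (fun j => (counit (b j) : K) - counit (a j))).
by rewrite -[RHS]eq0; apply: eq_bigr => j _; rewrite scalerBl.
Qed.

Lemma form_linear_comb c (a b : 'I_n -> A) :
  c *: (\sum_i a i ▷ omega i) + \sum_i b i ▷ omega i
  = \sum_i (c *: a i + b i) ▷ omega i.
Proof.
rewrite scaler_sumr -big_split /=; apply: eq_bigr => i _.
by rewrite (lact_linearl (omega i)).
Qed.

Lemma inv_coord_linear i : linear (inv_coord i).
Proof.
move=> c rho rho'.
have [a ->] := form_decomposition rho; have [b ->] := form_decomposition rho'.
by rewrite form_linear_comb !inv_coord_sum linearP.
Qed.

(** The i-th coordinate of rho, (id (x) c_i) (Delta_Gamma rho). *)
Definition coord (i : 'I_n) (rho : Gamma) : A :=
  tlift (fun x m => (inv_coord i m : K) *: x) (lcoact C rho).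

Let coord_bilin i : bilin (fun (x : A) (m : Gamma) => (inv_coord i m : K) *: x).
Proof.
split=> [m|x] c y z /=.
  by rewrite scalerDr !scalerA mulrC.
by rewrite inv_coord_linear scalerDl scalerA.
Qed.

Lemma coord_linear i : linear (coord i).
Proof.
apply: (linear_comp (tlift_linear (coord_bilin i))) => c x y.
by rewrite linearP.
Qed.

Lemma inv_coord_lact i j a :
  inv_coord i (a ▷ omega j) = counit a *+ (j == i).
Proof.
have -> : a ▷ omega j = \sum_k (a *+ (j == k)) ▷ omega k.
  rewrite (bigD1 j) //= eqxx big1 ?addr0 // => k.
  by rewrite eq_sym => /negPf ->; rewrite (lin0 (lact_linearl _)).
by rewrite inv_coord_sum raddfMn.
Qed.

Lemma coord_lact i j a : coord i (a ▷ omega j) = a *+ (j == i).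
Proof.
have [inv_omega _ _] := omega_basis.
rewrite /coord lcoact_left_invariant // (lin_sum (tlift_linear (coord_bilin i))).
(* a_(1) counit(a_(2)) = a. *)
rewrite -[in RHS](counitr a) [in RHS]/tlift -sumrMnl.
apply: eq_bigr => -[x y] _ /=.
by rewrite tlift_pure // inv_coord_lact scalerMnl.
Qed.

Lemma coord_sum i (a : 'I_n -> A) : coord i (\sum_j a j ▷ omega j) = a i.
Proof.
rewrite (lin_sum (coord_linear i)) (bigD1 i) //= coord_lact eqxx big1 ?addr0 //.
by move=> j /negPf jNi; rewrite coord_lact jNi.
Qed.

Lemma coordE rho : rho = \sum_i coord i rho ▷ omega i.
Proof.
have [a ->] := form_decomposition rho.
by apply: eq_bigr => i _; rewrite coord_sum.
Qed.

Lemma coord_lactM i a rho : coord i (a ▷ rho) = a * coord i rho.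
Proof.
have [b ->] := form_decomposition rho.
rewrite (lin_sum (lact_linearr a)) coord_sum.
by under eq_bigr do rewrite -lactM; rewrite coord_sum.
Qed.

Lemma coord_diff i b : coord i (diff C b) = conv (chi i) b.
Proof. by rewrite chiE coord_sum. Qed.

(** * The pairing of forms and vectorfields *)

(** The sum of the a_k V(b_k), for an arbitrarily chosen expression of rho as
    the sum of the a_k db_k. *)
Definition pairing (rho : Gamma) (V : A -> A) : A :=
  \sum_(p <- projT1 (cid (diff_gen C rho))) p.1 * V p.2.

Lemma vectorfieldE (v : 'I_n -> A) b :
  (\sum_i diamond (tvec chi i) (v i)) b = \sum_i conv (chi i) b * v i.
Proof. by rewrite fct_sumE. Qed.

Lemma pairing_coord rho (v : 'I_n -> A) :
  pairing rho (\sum_i diamond (tvec chi i) (v i)) = \sum_i coord i rho * v i.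
Proof.
rewrite /pairing; case: cid => s /= ->.
under [RHS]eq_bigr do rewrite (lin_sum (coord_linear _)) mulr_suml.
rewrite exchange_big; apply: eq_bigr => -[a b] _ /=.
rewrite vectorfieldE mulr_sumr; apply: eq_bigr => i _.
by rewrite coord_lactM coord_diff mulrA.
Qed.

Lemma pairing_linear V : V \in is_vectorfield chi -> linear (pairing^~ V).
Proof.
move=> /is_vectorfieldP[v ->] c x y; rewrite !pairing_coord.
rewrite scaler_sumr -big_split; apply: eq_bigr => i _ /=.
by rewrite coord_linear mulrDl scalerAl.
Qed.

Lemma pairing_lact V a rho : V \in is_vectorfield chi ->
  pairing (a ▷ rho) V = a * pairing rho V.
Proof.
move=> /is_vectorfieldP[v ->]; rewrite !pairing_coord mulr_sumr.
by apply: eq_bigr => i _; rewrite coord_lactM mulrA.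
Qed.

Lemma pairing_diff V b : V \in is_vectorfield chi ->
  pairing (diff C b) V = V b.
Proof.
move=> /is_vectorfieldP[v ->]; rewrite pairing_coord vectorfieldE.
by apply: eq_bigr => i _; rewrite coord_diff.
Qed.

Lemma tvecE j :
  tvec chi j = \sum_i diamond (tvec chi i) ((i == j)%:R).
Proof.
apply/funext => x; rewrite vectorfieldE (bigD1 j) //= eqxx mulr1.
by rewrite big1 ?addr0 // => i /negPf ->; rewrite mulr0.
Qed.

Lemma pairing_tvec rho j : pairing rho (tvec chi j) = coord j rho.
Proof.
rewrite tvecE pairing_coord (bigD1 j) //= eqxx mulr1.
by rewrite big1 ?addr0 // => i /negPf ->; rewrite mulr0.
Qed.

(** Linearity, the two module laws and the values on the bases determine a
    pairing. *)
Lemma bracket_coord (bracket : Gamma -> vectorfield chi -> A) :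
  (forall V, linear (bracket^~ V)) ->
  (forall V a rho, bracket (a ▷ rho) V = a * bracket rho V) ->
  (forall rho, linear (bracket rho)) ->
  (forall rho V b, bracket rho (vf_diamond V b) = bracket rho V * b) ->
  (forall i j, bracket (omega i) (vf_tvec chi j) = (i == j)%:R) ->
  forall rho (V : vectorfield chi) (v : 'I_n -> A),
    vf_fun V = \sum_i diamond (tvec chi i) (v i) ->
  bracket rho V = \sum_i coord i rho * v i.
Proof.
move=> linl lactl linr diar delta rho V v Vv.
have -> : V = \sum_j vf_diamond (vf_tvec chi j) (v j).
  by apply/val_inj; rewrite raddf_sum.
rewrite (lin_sum (linr rho)); apply: eq_bigr => j _.
rewrite diar {1}(coordE rho) (lin_sum (linl _)) (bigD1 j) //= lactl delta eqxx.
rewrite mulr1 big1 ?addr0 // => i /negPf iNj.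
by rewrite lactl delta iNj mulr0.
Qed.

End LeftCoaction.

Theorem theorem2p4p1 (R : realType) (A : hopfAlgType R[i])
    (Gamma : bimodType A) (C : bicovariant_calculus Gamma)
    (n : nat) (omega : 'I_n -> Gamma)
    (omega_basis : left_invariant_basis C omega)
    (chi : 'I_n -> {linear A -> R[i]^o})
    (chiE : dual_functionals C omega chi) :
  exists! bracket : Gamma -> vectorfield chi -> A,
    [/\ forall V : vectorfield chi,
          linear (fun rho => bracket rho V) /\
          (forall a rho, bracket (a ▷ rho) V = a * bracket rho V),
        forall rho : Gamma,
          linear (fun V => bracket rho V) /\
          (forall V b, bracket rho (vf_diamond V b) = bracket rho V * b),
        forall rho : Gamma, (forall V, bracket rho V = 0) -> rho = 0,
        forall V : vectorfield chi, (forall rho, bracket rho V = 0) -> V = 0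
      & forall i j : 'I_n, bracket (omega i) (vf_tvec chi j) = (i == j)%:R].
Proof.
exists (fun rho V => pairing C rho V); split; first split.
- move=> V; have VP := vf_funP V; split.
    exact: (pairing_linear omega_basis chiE VP).
  by move=> a rho; apply: (pairing_lact omega_basis chiE).
- move=> rho; split=> [c V W|V b]; rewrite /pairing.
    rewrite scaler_sumr -big_split; apply: eq_bigr => p _ /=.
    by rewrite mulrDr scalerAr.
  by rewrite mulr_suml; apply: eq_bigr => p _; rewrite /= mulrA.
- move=> rho rho0; rewrite (coordE omega_basis chiE rho) big1 // => i _.
  rewrite -(pairing_tvec omega_basis chiE).
  by rewrite (rho0 (vf_tvec chi i)) (lin0 (lact_linearl _)).
- move=> V V0; apply/val_inj/funext => b /=.
  by rewrite -(pairing_diff omega_basis chiE b (vf_funP V)) V0.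
- move=> i j; rewrite (pairing_tvec omega_basis chiE).
  by rewrite -[omega i]lact1 coord_lact.
move=> bracket [left_lin right_lin _ _ delta].
apply/funext => rho; apply/funext => V.
have /is_vectorfieldP[v Vv] := vf_funP V.
rewrite [in LHS]Vv (pairing_coord omega_basis chiE).
by rewrite (bracket_coord omega_basis chiE
  (fun V => (left_lin V).1) (fun V => (left_lin V).2)
  (fun rho => (right_lin rho).1) (fun rho => (right_lin rho).2) delta rho Vv).
Qed.
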